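(* For all integers $n\ge0$ and $c\ge1$, \begin{multline*} i_n^{(c)}=\frac{nc\left((-1)^c+1\right)}{4}r_{n-1}^{(c)}+c\left(c+1+(-1)^c\right)\binom{n}{2}r_{n-2}^{(c)}\\ +2c^2\left((-1)^c+2\right)\binom{n}{3}r_{n-3}^{(c)}+6c^3\binom{n}{4}r_{n-4}^{(c)}. \end{multline*}
   Context: Let $c\ge1$, $n\ge0$ be integers and $\Sigma_{c,n}=\{i^{[j]}:1\le i\le n,\ 0\le j<c\}$, with exponents read modulo $c$. A colored permutation is a bijection $\sigma:\Sigma_{c,n}\to\Sigma_{c,n}$ with $\sigma(i^{[j]})=(\sigma(i))^{[j]}$, where $(a^{[r]})^{[j]}=a^{[r+j\bmod c]}$ and $i=i^{[0]}$; writing $\sigma(i)=\sigma_i^{[c_i]}$ ($c_i\in\{0,\dots,c-1\}$), $\sigma$ is identified with the word $\sigma_1^{[c_1]}\cdots\sigma_n^{[c_n]}$, and $|\sigma|=\sigma_1\cdots\sigma_n$ is a permutation of $[n]$. $G_{c,n}$ is the set of colored permutations. For a permutation $\pi$, $\mathrm{inv}(\pi)=|\{(i,j):i<j,\ \pi_i>\pi_j\}|$; $\mathrm{col}(\sigma)=c_1+\cdots+c_n$; $\mathrm{inv}_c(\sigma)=\mathrm{inv}(|\sigma|)+\mathrm{col}(\sigma)+c\cdot|\{(i,j):1\le i<j\le n,\ \sigma_i<\sigma_j,\ c_j\ne0\}|$. A colored involution is $\sigma\in G_{c,n}$ with $\sigma\circ\sigma=\mathrm{id}$ on $\Sigma_{c,n}$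 (equivalently $|\sigma|$ is an involution, fixed points $i$ have $2c_i\equiv0\pmod c$, and 2-cycles $\{i,j\}$ have $c_i+c_j\equiv0\pmod c$). $r_m^{(c)}$ is the number of colored involutions in $G_{c,m}$ for $m\ge0$ ($r_0^{(c)}=1$), and $r_m^{(c)}=0$ for $m<0$. $i_n^{(c)}=\sum\mathrm{inv}_c(\sigma)$ over all colored involutions $\sigma\in G_{c,n}$. *)

(* Defs.v *)
From mathcomp Require Import all_boot all_order all_algebra all_fingroup.

Set Implicit Arguments.
Unset Strict Implicit.
Unset Printing Implicit Defensive.

(* [n] is represented by 'I_n: values are shifted down by 1, which does not
   affect any of the order comparisons below. *)

(* The alphabet Sigma_{c,n}; the pair (i, j) is the colored letter i^{[j]}. *)
Definition letter (c n : nat) : finType := ('I_n * 'I_c)%type.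

Definition add_color (c : nat) (r j : 'I_c) : 'I_c :=
  Ordinal (ltn_pmod (r + j) (leq_ltn_trans (leq0n r) (ltn_ord r))).

(* (a^{[r]})^{[j]} = a^{[r + j mod c]} *)
Definition add_exponent (c n : nat) (x : letter c n) (j : 'I_c) : letter c n :=
  (x.1, add_color x.2 j).

Section ColoredPermutations.

Variables (c : nat) (c_gt0 : 0 < c).

Definition uncolored (n : nat) (i : 'I_n) : letter c n := (i, Ordinal c_gt0).

Definition colored_perms (n : nat) : {set {perm letter c n}} :=
  [set s : {perm letter c n} | [forall i : 'I_n, forall j : 'I_c,
     s (i, j) == add_exponent (s (uncolored i)) j]].

(* The one-line word of s has i-th letter (abs_perm s i)^{[color s i]}. *)
Definition abs_perm (n : nat) (s : {perm letter c n}) (i : 'I_n) : 'I_n :=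
  (s (uncolored i)).1.

Definition color (n : nat) (s : {perm letter c n}) (i : 'I_n) : nat :=
  (s (uncolored i)).2.

Definition inv (n : nat) (p : 'I_n -> 'I_n) : nat :=
  #|[set ij : 'I_n * 'I_n | (ij.1 < ij.2) && (p ij.1 > p ij.2)]|.

Definition col (n : nat) (s : {perm letter c n}) : nat :=
  \sum_(i < n) color s i.

Definition inv_c (n : nat) (s : {perm letter c n}) : nat :=
  inv (abs_perm s) + col s
  + c * #|[set ij : 'I_n * 'I_n | [&& ij.1 < ij.2,
             abs_perm s ij.1 < abs_perm s ij.2 & color s ij.2 != 0]]|.

Definition colored_involutions (n : nat) : {set {perm letter c n}} :=
  [set s in colored_perms n | [forall x, s (s x) == x]].

Definition num_involutions (m : int) : nat :=
  match m with
  | Posz k => #|colored_involutions k|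
  | Negz _ => 0
  end.

Definition sum_inv_c (n : nat) : nat :=
  \sum_(s in colored_involutions n) inv_c s.

End ColoredPermutations.

(* Main.v *)
(** Delete the largest letter of a colored involution of [n], together with its
    partner if it is not fixed. Deleting a fixed letter of color x (so 2x = 0
    mod c) lowers inv_c by x + (n-1) c [x <> 0]; deleting the 2-cycle {k, n} with
    color x lowers it by 2(n-1-k) + 1 + c (2k-1) [x <> 0]. Neither amount depends
    on what remains. If e is the number of solutions of 2x = 0 mod c and E is
    their sum, then
      r_{n+1} = e r_n + c n r_{n-1},
      i_{n+1} = e i_n + (E + c n (e-1)) r_n + c n i_{n-1} + (c n)^2 r_{n-1}.
    By Pascal's rule, each sequence t_n = binom(n, j+1) r_{n-j-1} satisfies
    t_{n+1} = e t_n + c n t_{n-1} + binom(n, j) r_{n-j}, so a combination of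
    them solves the second recurrence. *)
Require Import Defs.
From mathcomp Require Import all_boot all_order all_algebra all_fingroup.
From mathcomp Require Import zify ring.

Set Implicit Arguments.
Unset Strict Implicit.
Unset Printing Implicit Defensive.

(** * Colored involutions in one-line notation *)

Section Words.

Variables (c : nat) (c_gt0 : 0 < c).

(** By equivariance, the images of the letters of color 0 determine a colored permutation. *)
Definition word n := {ffun 'I_n -> letter c n}.

Definition involutive_words n : {set word n} :=
  [set g : word n | [forall i, ((g (g i).1).1 == i)
                           && (c %| (g i).2 + (g (g i).1).2)]].

Lemma involutive_wordsP n (g : word n) :
  reflect (forall i, (g (g i).1).1 = i /\ c %| (g i).2 + (g (g i).1).2)
          (g \in involutive_words n).
Proof.
rewrite inE; apply: (iffP forallP) => [H i | H i].
  by have /andP[/eqP] := H i.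
by have [-> ->] := H i; rewrite eqxx.
Qed.

(** What [a], standing somewhere before [b], adds with it to [inv_c]; of the two colors only the
    later one counts. *)
Definition pair_weight n (a b : letter c n) : nat :=
  (b.1 < a.1) + c * ((a.1 < b.1) && (b.2 != 0 :> nat)).

Definition word_weight n (g : word n) : nat :=
  \sum_(i < n) \sum_(j < n) (i < j) * pair_weight (g i) (g j)
  + \sum_(i < n) (g i).2.

Definition word_of n (s : {perm letter c n}) : word n :=
  [ffun i => s (uncolored c_gt0 i)].

Lemma card_pairs n (P : pred ('I_n * 'I_n)) :
  #|[set ij | P ij]| = \sum_(i < n) \sum_(j < n) P (i, j).
Proof.
rewrite pair_big /= -sum1_card big_mkcond /=.
by apply: eq_bigr => -[i j] _; rewrite inE; case: (P _).
Qed.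

Lemma inv_c_word_of n (s : {perm letter c n}) :
  inv_c c_gt0 s = word_weight (word_of s).
Proof.
rewrite /inv_c /word_weight /Defs.inv /col addnAC.
rewrite !card_pairs /=.
congr (_ + _); last by apply: eq_bigr => i _; rewrite ffunE.
rewrite big_distrr -big_split; apply: eq_bigr => i _ /=.
rewrite big_distrr -big_split; apply: eq_bigr => j _ /=.
by rewrite /pair_weight !ffunE; case: (i < j) => /=; rewrite ?muln0 ?mul1n.
Qed.

Lemma add_color_mod0 (x y z : 'I_c) :
  c %| x + y -> add_color y (add_color x z) = z.
Proof.
move=> /dvdnP[q xyE]; apply: val_inj => /=.
by rewrite modnDmr addnA [y + x]addnC xyE modnMDl modn_small.
Qed.

Lemma add_color0 (x : 'I_c) : add_color x (Ordinal c_gt0) = x.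
Proof. by apply: val_inj; rewrite /= addn0 modn_small. Qed.

Lemma colored_permE n (s : {perm letter c n}) i j :
  s \in colored_perms c_gt0 n -> s (i, j) = add_exponent (word_of s i) j.
Proof. by rewrite inE ffunE => /forallP/(_ i)/forallP/(_ j)/eqP. Qed.

Lemma word_of_inj n : {in colored_perms c_gt0 n &, injective (@word_of n)}.
Proof.
move=> s t sP tP st; apply/permP => -[i j].
by rewrite !colored_permE // st.
Qed.

(** Conversely to reading off the word, the equivariant extension [f] of an involutive word is its
    own inverse, hence a permutation. *)
Lemma word_of_involutions n :
  @word_of n @: colored_involutions c_gt0 n = involutive_words n.
Proof.
apply/setP => g; apply/imsetP/involutive_wordsP => [[s] | gP].
  rewrite inE => /andP[sP /forallP sK] -> i.
  have /eqP := sK (uncolored c_gt0 i).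
  rewrite colored_permE // /add_exponent add_color0 -surjective_pairing.
  rewrite [word_of s i]surjective_pairing colored_permE // => -[-> /=].
  by rewrite addnC => /eqP.
pose f (x : letter c n) := add_exponent (g x.1) x.2.
have fK : involutive f.
  case=> i j; rewrite /f /=; have [gi gc] := gP i.
  by rewrite /add_exponent gi (add_color_mod0 _ gc).
have sE i j : perm (inv_inj fK) (i, j) = add_exponent (g i) j by rewrite permE.
exists (perm (inv_inj fK)); last first.
  by apply/ffunP => i; rewrite ffunE sE /add_exponent add_color0 -surjective_pairing.
rewrite !inE; apply/andP; split.
  apply/forallP => i; apply/forallP => j.
  by rewrite !sE /add_exponent add_color0.
by apply/forallP => x; rewrite !permE fK.
Qed.

Lemma sum_involutions n (F : word n -> nat) :
  \sum_(s in colored_involutions c_gt0 n) F (word_of s)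
  = \sum_(g in involutive_words n) F g.
Proof.
rewrite -word_of_involutions big_imset // => s t.
rewrite !inE => /andP[sP _] /andP[tP _]; apply: word_of_inj; by rewrite inE.
Qed.

(** * Inserting letters: relabelling a word along an injection *)

Definition extend m n (e : 'I_m -> 'I_n) (b : word n) (h : word m) : word n :=
  [ffun i => if [pick j | e j == i] is Some j then (e (h j).1, (h j).2) else b i].

Lemma extend_in m n (e : 'I_m -> 'I_n) b h j : injective e ->
  extend e b h (e j) = (e (h j).1, (h j).2).
Proof.
move=> e_inj; rewrite ffunE; case: pickP => [k /eqP/e_inj-> // | /(_ j)].
by rewrite eqxx.
Qed.

Lemma extend_out m n (e : 'I_m -> 'I_n) b h i : i \notin codom e ->
  extend e b h i = b i.
Proof.
move=> ie; rewrite ffunE; case: pickP => // k /eqP ki.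
by rewrite -ki codom_f in ie.
Qed.

(** As [b] is involutive off the image of [e] and stays there, an involutive word agreeing with [b]
    there preserves the image of [e], so it restricts to an involutive word on ['I_m]. *)
Lemma sum_extend m n (e : 'I_m -> 'I_n) (b : word n) (F : word n -> nat) :
    injective e ->
    (forall i, i \notin codom e ->
       [/\ (b i).1 \notin codom e, (b (b i).1).1 = i
         & c %| (b i).2 + (b (b i).1).2]) ->
  \sum_(g in involutive_words n | [forall (i | i \notin codom e), g i == b i]) F g
  = \sum_(h in involutive_words m) F (extend e b h).
Proof.
move=> e_inj bP; rewrite -[RHS](big_imset F) /=; last first.
  move=> h h' _ _ hh'; apply/ffunP => j.
  have := congr1 (fun g : word n => g (e j)) hh'.
  by rewrite !extend_in // => -[/e_inj]; case: (h j) (h' j) => ? ? [? ?] /= -> ->.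
apply: eq_bigl => g; apply/andP/imsetP => [[/involutive_wordsP gP /forall_inP gb] | ].
  (* Otherwise [g] agrees with [b] at that point and would stay outside the image, yet it returns to
     [e j]. *)
  have ge j : (g (e j)).1 \in codom e.
    apply/negPn/negP => gj; have [gjK _] := gP (e j).
    have [] := bP _ gj; rewrite -(eqP (gb _ gj)) gjK.
    by rewrite codom_f.
  pose h := [ffun j => (iinv (ge j), (g (e j)).2)] : word m.
  have he j : e (h j).1 = (g (e j)).1 by rewrite ffunE f_iinv.
  have h2 j : (h j).2 = (g (e j)).2 by rewrite ffunE.
  exists h.
    apply/involutive_wordsP => j; have [g1 g2] := gP (e j); split.
      by apply: e_inj; rewrite !he.
    by rewrite !h2 he.
  apply/ffunP => i; have [/codomP[j ->] | ie] := boolP (i \in codom e).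
    by rewrite extend_in // he h2 -surjective_pairing.
  by rewrite extend_out // (eqP (gb _ ie)).
case=> h /involutive_wordsP hP ->; split; last first.
  by apply/forall_inP => i ie; rewrite extend_out.
apply/involutive_wordsP => i; have [/codomP[j ->] | ie] := boolP (i \in codom e).
  by rewrite !(extend_in _ _ _ e_inj) /=; have [-> ->] := hP j.
by have [b1 b2 b3] := bP i ie; rewrite (extend_out _ _ ie) extend_out.
Qed.

(** * Adding a largest letter, fixed or in a 2-cycle *)

Definition opp_color (x : 'I_c) : 'I_c := Ordinal (ltn_pmod (c - x) c_gt0).

(** The sum is taken in the natural numbers: it is the share of a 2-cycle in [col]. *)
Lemma add_opp_color_nat (x : 'I_c) : x + opp_color x = c * (x != 0 :> nat).
Proof.
rewrite /=; case: (posnP x) => [-> | x0]; first by rewrite subn0 modnn muln0.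
by have xc := ltn_ord x; rewrite modn_small; lia.
Qed.

Lemma opp_color_eq0 (x : 'I_c) : (opp_color x == 0 :> nat) = (x == 0 :> nat).
Proof.
have := add_opp_color_nat x; have := ltn_ord x; have := ltn_ord (opp_color x).
by case: eqP => [->|]; lia.
Qed.

Lemma opp_color_unique (x y : 'I_c) : c %| x + y -> y = opp_color x.
Proof.
move=> xy; apply: val_inj; suff: y == opp_color x %[mod c].
  by rewrite !modn_small ?ltn_ord // => /eqP.
by rewrite -(eqn_modDl x) add_opp_color_nat (eqP xy) modnMr.
Qed.

Definition extend_fixed n (x : 'I_c) : word n -> word n.+1 :=
  extend (lift ord_max) [ffun=> (ord_max, x)].

Definition skip_pair n (k : 'I_n.+1) (j : 'I_n) : 'I_n.+2 :=
  lift ord_max (lift k j).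

Definition extend_pair n (k : 'I_n.+1) (x : 'I_c) : word n -> word n.+2 :=
  extend (skip_pair k)
    [ffun i => if i == ord_max then (lift ord_max k, x) else (ord_max, opp_color x)].

Lemma skip_pair_inj n (k : 'I_n.+1) : injective (skip_pair k).
Proof. by move=> i j /lift_inj/lift_inj. Qed.

Lemma codom_lift n (k i : 'I_n.+1) : (i \in codom (lift k)) = (i != k).
Proof.
apply/codomP/idP => [[j ->] | ik]; first by rewrite eq_sym neq_lift.
by rewrite eq_sym in ik; have [j ->] := unlift_some ik; exists j.
Qed.

Lemma codom_skip_pair n (k : 'I_n.+1) i :
  (i \in codom (skip_pair k)) = (i != ord_max) && (i != lift ord_max k).
Proof.
apply/codomP/andP => [[j ->] | [iM iK]].
  by rewrite eq_sym neq_lift (inj_eq lift_inj) eq_sym neq_lift.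
rewrite eq_sym in iM; have [j ij _] := unlift_some iM.
move: iK; rewrite ij (inj_eq lift_inj) eq_sym => /unlift_some[j' jj' _].
by exists j'; rewrite /skip_pair -jj'.
Qed.

Lemma sum_fixed_last n (x : 'I_c) (F : word n.+1 -> nat) : c %| x + x ->
  \sum_(g in involutive_words n.+1 | g ord_max == (ord_max, x)) F g
  = \sum_(h in involutive_words n) F (extend_fixed x h).
Proof.
move=> xx; rewrite -sum_extend; first last.
- by move=> i; rewrite !codom_lift !ffunE eqxx /= negbK => /eqP->.
- exact: lift_inj.
apply: eq_bigl => g; congr (_ && _); apply/eqP/forall_inP => [gM i | H].
  by rewrite codom_lift negbK => /eqP->; rewrite gM ffunE.
by have := H ord_max; rewrite codom_lift eqxx ffunE => /(_ isT)/eqP.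
Qed.

Lemma sum_paired_last n (k : 'I_n.+1) (x : 'I_c) (F : word n.+2 -> nat) :
  \sum_(g in involutive_words n.+2 | g ord_max == (lift ord_max k, x)) F g
  = \sum_(h in involutive_words n) F (extend_pair k x h).
Proof.
have KM : (lift ord_max k == ord_max) = false.
  by rewrite eq_sym (negbTE (neq_lift _ _)).
have xN : c %| x + opp_color x by rewrite add_opp_color_nat dvdn_mulr.
rewrite -sum_extend; first last.
- move=> i; rewrite !codom_skip_pair !ffunE negb_and !negbK => /orP[] /eqP->.
    by rewrite !eqxx /= KM andbF.
  by rewrite KM !eqxx /= addnC.
- exact: skip_pair_inj.
apply: eq_bigl => g; apply: andb_id2l => /involutive_wordsP gP.
apply/eqP/forall_inP => [gM i | H].
  (* The image of the last letter determines that of its partner, including the opposite color. *)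
  have [gK gc] := gP ord_max; rewrite gM /= in gK gc.
  rewrite codom_skip_pair negb_and !negbK ffunE => /orP[] /eqP->.
    by rewrite eqxx gM.
  by rewrite KM [g _]surjective_pairing gK (opp_color_unique gc).
by have := H ord_max; rewrite codom_skip_pair !eqxx ffunE eqxx => /(_ isT)/eqP.
Qed.

(** The words are sorted by the image of [ord_max]; a fixed last letter has a self-opposite color.
    The 2-cycles stay unexpanded because removing one requires [n] to be a successor. *)
Lemma sum_by_last n (F : word n.+1 -> nat) :
  \sum_(g in involutive_words n.+1) F g
  = \sum_(x < c | c %| x + x) \sum_(h in involutive_words n) F (extend_fixed x h)
    + \sum_(k < n) \sum_(x < c)
        \sum_(g in involutive_words n.+1 | g ord_max == (lift ord_max k, x)) F g.
Proof.
rewrite (partition_big (fun g : word n.+1 => g ord_max) xpredT) //=.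
rewrite -(pair_bigA _ (fun k x =>
  \sum_(g in involutive_words n.+1 | g ord_max == (k, x)) F g)) /=.
rewrite (bigD1_ord ord_max) //=; congr (_ + _).
rewrite [RHS]big_mkcond; apply: eq_bigr => x _.
case: ifP => xx; first exact: sum_fixed_last.
apply: big_pred0 => g; apply/andP => -[/involutive_wordsP/(_ ord_max)[_ gc] /eqP gM].
by rewrite gM /= gM /= xx in gc.
Qed.

(** * Change of the weight under insertion *)

Lemma lift_ltn n (k : 'I_n.+1) (i j : 'I_n) : (lift k i < lift k j) = (i < j).
Proof. by rewrite /= /bump; lia. Qed.

Lemma sum_ltn m k : \sum_(i < m) (i < k) = minn k m.
Proof. by elim: m => [|m IH]; rewrite ?big_ord0 ?big_ord_recr /= ?IH; lia. Qed.

Lemma sum_lift_ltn m (k : 'I_m.+1) : \sum_(i < m) (lift k i < k) = k.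
Proof.
rewrite (eq_bigr (fun i : 'I_m => i < k : nat)); last by move=> i _; rewrite /= /bump; lia.
by rewrite sum_ltn; have := ltn_ord k; lia.
Qed.

Lemma sum_ltn_lift m (k : 'I_m.+1) : \sum_(i < m) (k < lift k i) = m - k.
Proof.
(* With the [k] indices below [k] added, each of the [m] indices is counted exactly once. *)
apply/eqP; rewrite -(eqn_add2r k) -[X in _ + X](sum_lift_ltn k) -big_split /=.
rewrite (eq_bigr (fun=> 1)); last by move=> i _; rewrite /= /bump; lia.
by rewrite sum1_card card_ord subnK // -ltnS.
Qed.

Lemma sum_pairs_lift n (k : 'I_n.+1) (t : 'I_n.+1 -> 'I_n.+1 -> nat) :
  \sum_(i < n.+1) \sum_(j < n.+1) (i < j) * t i j
  = \sum_(i < n) (k < lift k i) * t k (lift k i)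
    + \sum_(i < n) (lift k i < k) * t (lift k i) k
    + \sum_(i < n) \sum_(j < n) (i < j) * t (lift k i) (lift k j).
Proof.
rewrite !(bigD1_ord k) //= ltnn mul0n add0n -addnA; congr (_ + _).
rewrite -big_split; apply: eq_bigr => i _; rewrite (bigD1_ord k) //=.
by congr (_ + _); apply: eq_bigr => j _; rewrite -(lift_ltn k).
Qed.

Lemma sum_pairs_last n (t : 'I_n.+1 -> 'I_n.+1 -> nat) :
  \sum_(i < n.+1) \sum_(j < n.+1) (i < j) * t i j
  = \sum_(i < n) t (lift ord_max i) ord_max
    + \sum_(i < n) \sum_(j < n) (i < j) * t (lift ord_max i) (lift ord_max j).
Proof.
rewrite (sum_pairs_lift ord_max) big1 => [|i _]; last first.
  by rewrite /= /bump; have := ltn_ord i; lia.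
rewrite add0n; congr (_ + _); apply: eq_bigr => i _.
by rewrite lift_max ltn_ord mul1n.
Qed.

Lemma pair_weight_lift n (k : 'I_n.+1) (a b : 'I_n) (x y : 'I_c) :
  pair_weight (lift k a, x) (lift k b, y) = pair_weight (a, x) (b, y).
Proof. by rewrite /pair_weight /fst !lift_ltn. Qed.

Lemma pair_weight_max_l n (a : 'I_n) (x y : 'I_c) :
  pair_weight (ord_max, x) (lift ord_max a, y) = 1.
Proof.
by rewrite /pair_weight /fst lift_max ltn_ord ltnNge (ltnW (ltn_ord a)) muln0.
Qed.

Lemma pair_weight_max_r n (a : 'I_n) (x y : 'I_c) :
  pair_weight (lift ord_max a, x) (ord_max, y) = c * (y != 0 :> nat).
Proof.
by rewrite /pair_weight /fst lift_max ltn_ord ltnNge (ltnW (ltn_ord a)).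
Qed.

(** The largest letter in last position makes no inversion; it forms an ascent with each of the [n]
    letters before it. *)
Lemma word_weight_extend_fixed n (x : 'I_c) (h : word n) :
  word_weight (extend_fixed x h)
  = word_weight h + (x + n * (c * (x != 0 :> nat))).
Proof.
have gM : extend_fixed x h ord_max = (ord_max, x).
  by rewrite extend_out ?ffunE // codom_lift eqxx.
have gL i : extend_fixed x h (lift ord_max i) = (lift ord_max (h i).1, (h i).2).
  by rewrite extend_in //; apply: lift_inj.
rewrite /word_weight sum_pairs_last (bigD1_ord ord_max) //= gM.
under eq_bigr => i _ do rewrite gL pair_weight_max_r.
under [X in _ + X + _]eq_bigr => i _.
  under eq_bigr => j _ do rewrite !gL pair_weight_lift -!surjective_pairing.
  over.
under [X in _ + (_ + X)]eq_bigr => i _ do rewrite gL /=.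
by rewrite sum_nat_const card_ord /=; ring.
Qed.

(** The underlying map is an involution, so the values run through all indices once. *)
Lemma sum_permuted n (h : word n) (F : 'I_n -> nat) :
  h \in involutive_words n -> \sum_(i < n) F (h i).1 = \sum_(i < n) F i.
Proof.
move=> /involutive_wordsP hP; rewrite [RHS](reindex_inj (h := fun i => (h i).1)) //.
by apply: (can_inj (g := fun i => (h i).1)) => i; have [] := hP i.
Qed.

(** The largest letter, at position [k], is inverted with the [n - k] old letters after it and
    ascends from the [k] before it. The last letter has value [k]: it is inverted with the [n - k]
    larger old values and ascends from the [k] smaller ones. The two new letters form one inversion,
    and their colors add up to [c] or 0. *)
Lemma word_weight_extend_pair n (k : 'I_n.+1) (x : 'I_c) (h : word n) :
  h \in involutive_words n ->
  word_weight (extend_pair k x h)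
  = word_weight h + (1 + 2 * (n - k) + c * (x != 0 :> nat) * (1 + 2 * k)).
Proof.
move=> hP; set g := extend_pair k x h.
have KM : (lift ord_max k == ord_max) = false.
  by rewrite eq_sym (negbTE (neq_lift _ _)).
have gM : g ord_max = (lift ord_max k, x).
  by rewrite /g extend_out ?ffunE ?eqxx // codom_skip_pair eqxx.
have gK : g (lift ord_max k) = (ord_max, opp_color x).
  by rewrite /g extend_out ?ffunE ?KM // codom_skip_pair eqxx andbF.
have gL i : g (lift ord_max (lift k i)) =
    (lift ord_max (lift k (h i).1), (h i).2).
  by rewrite /g extend_in //; apply: skip_pair_inj.
rewrite /word_weight sum_pairs_last (sum_pairs_lift k).
rewrite !(bigD1_ord ord_max (F := fun i => nat_of_ord (g i).2)) //=.
rewrite !(bigD1_ord k) //= gM gK.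
have -> : \sum_(i < n) pair_weight (g (lift ord_max (lift k i))) (lift ord_max k, x)
          = n - k + c * (x != 0 :> nat) * k.
  under eq_bigr => i _ do rewrite gL pair_weight_lift /pair_weight /fst /snd.
  (* Only the values of the old letters matter here, so their order may be forgotten. *)
  rewrite (sum_permuted (fun i => (k < lift k i) + c * ((lift k i < k) && (x != 0 :> nat)))) //.
  rewrite big_split /= sum_ltn_lift -big_distrr -mulnA; congr (_ + _ * _).
  case: (_ != _); last by rewrite big1 // => i _; rewrite andbF.
  by rewrite mul1n -[RHS]sum_lift_ltn; apply: eq_bigr => i _; rewrite andbT.
rewrite pair_weight_max_l.
have -> : \sum_(i < n) (k < bump k i) * pair_weight (ord_max, opp_color x)
            (g (lift ord_max (lift k i))) = n - k.
  rewrite -(sum_ltn_lift k); apply: eq_bigr => i _.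
  by rewrite gL pair_weight_max_l muln1.
have -> : \sum_(i < n) (bump k i < k) * pair_weight (g (lift ord_max (lift k i)))
            (ord_max, opp_color x) = c * (x != 0 :> nat) * k.
  rewrite -[X in _ = _ * X](sum_lift_ltn k) big_distrr; apply: eq_bigr => i _.
  by rewrite gL pair_weight_max_r opp_color_eq0 mulnC.
under eq_bigr => i _.
  under eq_bigr => j _ do rewrite !gL !pair_weight_lift -!surjective_pairing.
  over.
under [X in _ + (_ + (_ + X))]eq_bigr => i _ do rewrite gL /=.
by rewrite /snd [x + (_ + _)]addnA add_opp_color_nat; ring.
Qed.

(** * Recurrences for the number and the total weight *)

Lemma sum_self_opposite (F : nat -> nat) :
  \sum_(x < c | c %| x + x) F x = F 0 + ~~ odd c * F c./2.
Proof.
rewrite (bigD1 (Ordinal c_gt0)) ?dvdn0 //=; congr (_ + _).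
(* The quotient of [x + x] by [c] is below 2 since [x < c], and it is 0 only for [x = 0]. *)
have small (x : 'I_c) : c %| x + x -> x != Ordinal c_gt0 -> x + x = c.
  move=> /dvdnP[q]; rewrite -val_eqE /=; have := ltn_ord x.
  by case: q => [|[|q]]; rewrite ?mulSn; lia.
case: (boolP (odd c)) => [c_odd | c_even].
  rewrite mul0n big_pred0 // => x; apply/andP => -[/small H /H xx].
  by rewrite -xx addnn odd_double in c_odd.
have cE : c = c./2.*2 by rewrite even_halfK.
have half_lt : c./2 < c by lia.
rewrite mul1n (big_pred1 (Ordinal half_lt)) // => x.
apply/andP/eqP => [[/small H /H xx] | ->]; first by apply: val_inj => /=; lia.
by rewrite -val_eqE /= addnn -cE dvdnn; split => //; lia.
Qed.

Lemma sum_neq0 : \sum_(x < c) (x != 0 :> nat) = c.-1.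
Proof.
rewrite (bigD1 (Ordinal c_gt0)) //= add0n (eq_bigr (fun=> 1)).
  by rewrite sum1_card cardC1 card_ord.
by move=> x; rewrite -val_eqE /= => ->.
Qed.

Lemma sum_odd n : \sum_(k < n) (1 + 2 * k) = n ^ 2.
Proof. by elim: n => [|n IH]; rewrite ?big_ord0 ?big_ord_recr /= ?IH; lia. Qed.

Lemma sum_odd_rev n : \sum_(k < n.+1) (1 + 2 * (n - k)) = n.+1 ^ 2.
Proof. by rewrite -sum_odd [RHS](reindex_inj rev_ord_inj). Qed.

Lemma card_involutive_wordsS n :
  #|involutive_words n.+1|
  = (1 + ~~ odd c) * #|involutive_words n| + c * n * #|involutive_words n.-1|.
Proof.
rewrite -!sum1_card sum_by_last; congr (_ + _).
  by rewrite sum1_card (sum_self_opposite (fun=> _)) mulnDl mul1n.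
(* For [n = 0] there is no partner, and the factor [n] cancels the truncated [n.-1]. *)
case: n => [|n]; first by rewrite big_ord0 muln0.
transitivity (\sum_(k < n.+1) \sum_(x < c) #|involutive_words n|).
  by apply: eq_bigr => k _; apply: eq_bigr => x _; rewrite sum_paired_last sum1_card.
by rewrite !sum_nat_const !card_ord /=; ring.
Qed.

Definition total_weight n := \sum_(g in involutive_words n) word_weight g.

Lemma total_weightS n :
  total_weight n.+1
  = (1 + ~~ odd c) * total_weight n
    + ~~ odd c * (c./2 + c * n) * #|involutive_words n|
    + c * n * total_weight n.-1 + (c * n) ^ 2 * #|involutive_words n.-1|.
Proof.
rewrite {1}/total_weight sum_by_last -addnA; congr (_ + _).
  under eq_bigr => x _.
    under eq_bigr => h _ do rewrite word_weight_extend_fixed.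
    rewrite big_split sum_nat_const /=.
    over.
  rewrite (sum_self_opposite (fun x => _ + _ * (x + n * (c * (x != 0 :> nat))))).
  (* Half of an even positive [c] is a nonzero color, so it contributes the full ascent term. *)
  have : ~~ odd c * (c./2 != 0) = ~~ odd c.
    case: (boolP (odd c)) => //= c_even; rewrite mul1n; lia.
  rewrite -/(total_weight n).
  rewrite eqxx; case: (odd c) => /=; first by move=> _; ring.
  by rewrite !mul1n => ->; ring.
case: n => [|n]; first by rewrite big_ord0 !muln0.
pose R := #|involutive_words n|.
transitivity (\sum_(k < n.+1) (c * total_weight n + c * (1 + 2 * (n - k)) * R
   + c * c.-1 * (1 + 2 * k) * R)).
  apply: eq_bigr => k _.
  transitivity (\sum_(x < c) (total_weight n + (1 + 2 * (n - k)) * R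
     + (x != 0 :> nat) * (c * (1 + 2 * k) * R))).
    apply: eq_bigr => x _; rewrite sum_paired_last.
    under eq_bigr => h hP do rewrite word_weight_extend_pair //.
    by rewrite big_split sum_nat_const /= -/(total_weight n) -/R; ring.
  by rewrite big_split sum_nat_const /= -big_distrl /= sum_neq0 card_ord; ring.
rewrite !big_split sum_nat_const card_ord /= -!big_distrl -!big_distrr /=.
rewrite sum_odd sum_odd_rev.
(* The inversions occur for all [c] colors, the color terms for the [c.-1] nonzero ones; both carry
   the sum of odd numbers [n.+1 ^ 2]. *)
have cc : c ^ 2 = c + c * c.-1 by rewrite -mulnS prednK.
by rewrite expnMn cc; ring.
Qed.

End Words.

Lemma total_weight0 c : total_weight c 0 = 0.
Proof. by apply: big1 => g _; rewrite /word_weight !big_ord0. Qed.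

Import GRing.Theory.
Local Open Scope ring_scope.

(** * Solving the recurrence over the rationals *)

Section Recurrence.

Variables (e E C : rat) (r w : nat -> rat).
Hypothesis rS : forall n, r n.+1 = e * r n + C * n%:R * r n.-1.

(** Pascal's rule splits the left side; in the part with binom(n, j+1), [rS] expands r_{n-j}, and
    (n-j-1) binom(n, j+1) = n binom(n-1, j+1) absorbs the new factor. *)
Lemma binomial_term_rec j n :
  'C(n.+1, j.+1)%:R * r (n.+1 - j.+1)%N
  = e * ('C(n, j.+1)%:R * r (n - j.+1)%N)
    + C * n%:R * ('C(n.-1, j.+1)%:R * r (n.-1 - j.+1)%N) + 'C(n, j)%:R * r (n - j)%N.
Proof.
have [nj | jn] := leqP n j.
  rewrite subSS binS !(bin_small (m := j.+1)) ?add0n; [ring | lia | lia].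
have -> : (n - j = (n - j.+1).+1)%N by lia.
rewrite subSS binS natrD.
have -> : (n - j = (n - j.+1).+1)%N by lia.
rewrite mulrDl rS.
have -> : C * n%:R * ('C(n.-1, j.+1)%:R * r (n.-1 - j.+1)%N)
    = C * (n - j.+1)%:R * 'C(n, j.+1)%:R * r (n - j.+1).-1.
  rewrite -!mulrA; congr (_ * _); rewrite !mulrA -!natrM mul_bin_down.
  by congr (_ * r _); lia.
ring.
Qed.

Hypothesis w0 : w 0%N = 0.
Hypothesis wS : forall n, w n.+1 =
  e * w n + (E + C * n%:R * (e - 1)) * r n + C * n%:R * w n.-1
  + (C * n%:R) ^+ 2 * r n.-1.

Lemma bin2_rat n : 'C(n, 2)%:R = n%:R * (n%:R - 1) / 2 :> rat.
Proof. by elim: n => [|n IH]; rewrite ?mul0r // binS bin1 natrD IH -natr1; field. Qed.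

Lemma bin3_rat n : 'C(n, 3)%:R = n%:R * (n%:R - 1) * (n%:R - 2) / 6 :> rat.
Proof.
by elim: n => [|n IH]; rewrite ?mul0r // binS natrD IH bin2_rat -natr1; field.
Qed.

(* Where [n - j] or [n.-1] truncates, its coefficient vanishes. *)
Lemma recurrence_solution n :
  w n = E * (n%:R * r (n - 1)%N)
    + (C * e * (e - 1) + C ^+ 2) * ('C(n, 2)%:R * r (n - 2)%N)
    + 2 * C ^+ 2 * (2 * e - 1) * ('C(n, 3)%:R * r (n - 3)%N)
    + 6 * C ^+ 3 * ('C(n, 4)%:R * r (n - 4)%N).
Proof.
(* Strong induction, as [wS] reaches back two steps. *)
have [k] := ubnP n; elim: k n => // k IH [_|n nk]; first by rewrite w0 !bin0n /=; ring.
rewrite wS !IH; try lia.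
(* The factor [n.+1] is written as a binomial so that the first term is also of the form treated by
   [binomial_term_rec]. *)
rewrite -[X in X%:R * r (n.+1 - 1)%N]bin1 !binomial_term_rec !bin0 !bin1 bin2_rat bin3_rat.
case: n {nk} => [|n]; first by rewrite !bin0n /=; ring.
case: n => [|n]; first by rewrite /= !rS; field.
(* With m for [n.+2], the claim left is C m (e-1) r_m + (C m)^2 r_{m-1} = a m r_{m-1} + b binom(m,
   2) r_{m-2} + d binom(m, 3) r_{m-3}, where a, b, d are the last three coefficients. It follows
   from [rS] and m^2 = m + m(m-1). *)
by rewrite /= !subSS !subn0 !rS /= -subn1; field.
Qed.

End Recurrence.

Theorem theorem5p3 (n c : nat) (c_gt0 : (0 < c)%N) :
  let N := n%:R : rat in
  let C := c%:R : rat in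
  let r (m : int) := (num_involutions c_gt0 m)%:R : rat in
  (sum_inv_c c_gt0 n)%:R =
    N * C * ((-1) ^+ c + 1) / 4 * r (n%:Z - 1)
    + C * (C + 1 + (-1) ^+ c) * 'C(n, 2)%:R * r (n%:Z - 2)
    + 2 * C ^+ 2 * ((-1) ^+ c + 2) * 'C(n, 3)%:R * r (n%:Z - 3)
    + 6 * C ^+ 3 * 'C(n, 4)%:R * r (n%:Z - 4).
Proof.
pose e : rat := (1 + ~~ odd c)%:R; pose E : rat := (~~ odd c * c./2)%:R.
pose x n := #|involutive_words c n|%:R : rat.
pose y n := (total_weight c n)%:R : rat.
have xS k : x k.+1 = e * x k + c%:R * k%:R * x k.-1.
  by rewrite /x (card_involutive_wordsS c_gt0) natrD !natrM.
have y0 : y 0%N = 0 by rewrite /y total_weight0.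
have yS k : y k.+1 = e * y k + (E + c%:R * k%:R * (e - 1)) * x k
    + c%:R * k%:R * y k.-1 + (c%:R * k%:R) ^+ 2 * x k.-1.
  by rewrite /y (total_weightS c_gt0) /e /E /x !(natrD, natrM); ring.
(* [e] is 2 for even [c] and 1 for odd [c], so every parity term is a polynomial in [e]. *)
have eE : (-1) ^+ c = 2 * e - 3 :> rat.
  by rewrite /e -signr_odd; case: (odd c).
have EE : E = c%:R * (e - 1) / 2.
  rewrite /E /e; case: (boolP (odd c)) => [_ | /even_halfK cE]; first by rewrite /=; ring.
  by rewrite -[X in X%:R * _ / _]cE -muln2 mul1n natrM /=; field.
(* Both values are roots of (e-1)(e-2); this makes e(e-1) equal to 2e-2, that is (-1)^c + 1. *)
have e12 : e * e = 3 * e - 2 by rewrite /e; case: (odd c).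
have numE k : (num_involutions c_gt0 (Posz k))%:R = x k.
  rewrite /x /= -!sum1_card; congr (_ %:R).
  exact: (sum_involutions c_gt0 (fun=> 1%N)).
(* For [k > n] the integer index is negative while the natural one truncates to 0; the vanishing
   binomial reconciles them. *)
have rE (k : nat) : ('C(n, k)%:R : rat) * (num_involutions c_gt0 (n%:Z - k%:Z))%:R
    = 'C(n, k)%:R * x (n - k)%N.
  have [kn | nk] := leqP k n; first by rewrite subzn // numE.
  by rewrite bin_small // !mul0r.
move=> N C r.
have -> : (sum_inv_c c_gt0 n)%:R = y n.
  congr (_ %:R); rewrite /total_weight -(sum_involutions c_gt0).
  by apply: eq_bigr => s _; apply: inv_c_word_of.
rewrite (recurrence_solution xS y0 yS) -[n in n%:R * x _]bin1 -!rE bin1.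
rewrite -/(r (n%:Z - 1)) -/(r (n%:Z - 2)) -/(r (n%:Z - 3)) -/(r (n%:Z - 4)).
rewrite -[c%:R * e * _]mulrA mulrBr e12 eE EE -/N -/C.
by field.
Qed.
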